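(* Let $f:\Gamma\to\mathbb{R}$ be a smooth symmetric function on the cone $\Gamma\subsetneq\mathbb{R}^n$. Assume that $f$ is concave in $\Gamma$, that $\lim_{t\to+\infty}f(t\lambda)>-\infty$ for every $\lambda\in\Gamma_n$, and that $\sum_{i=1}^n f_i(\lambda)>0$ for all $\lambda\in\Gamma$. Then the following statements are mutually equivalent. (1) $(0,\dots,0,1)\in\mathring{\Gamma}_{\mathcal{G}}^{f}$, i.e. $\mathring{\Gamma}_{\mathcal{G}}^{f}$ is of type 2 in the sense of Caffarelli–Nirenberg–Spruck. (2) $f$ is of fully uniform ellipticity in $\Gamma$. (3) $f$ is of fully uniform ellipticity in $\partial\Gamma^\sigma$ for some $\sigma\in(\sup_{\partial\Gamma}f,\ \sup_\Gamma f)$.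
   Context: $\Gamma\subsetneq\mathbb{R}^n$ is an open convex cone with vertex at the origin, invariant under permutations of coordinates, with nonempty boundary $\partial\Gamma$, and containing $\Gamma_n=\{\lambda\in\mathbb{R}^n:\text{each }\lambda_i>0\}$. Write $f_i=\partial f/\partial\lambda_i$. $\sup_{\partial\Gamma}f=\sup_{\lambda^0\in\partial\Gamma}\limsup_{\lambda\to\lambda^0}f(\lambda)$ (with $\lambda\in\Gamma$). For $\sigma\in(\sup_{\partial\Gamma}f,\sup_\Gamma f)$, $\partial\Gamma^\sigma=\{\lambda\in\Gamma: f(\lambda)=\sigma\}$. Asymptotical cone: $\Gamma_{\mathcal{G}}^{f}=\{\lambda\in\Gamma:\lim_{t\to+\infty}f(t\lambda)>-\infty\}$, with interior $\mathring{\Gamma}_{\mathcal{G}}^{f}$. Fully uniform ellipticity: for a symmetric subset $\mathcal{S}$ of $\{\lambda\in\Gamma: f(\lambda)<\sup_\Gamma f\}$, $f$ is of fully uniform ellipticity in $\mathcal{S}$ if $f_i\ge 0$ in $\Gamma$ for all $1\le i\le n$ and there is a uniform constant $\vartheta>0$ such that $f_i(\lambda)\ge\vartheta\sum_{j=1}^n f_j(\lambda)>0$ for all $\lambda\in\mathcal{S}$ and all $1\le i\le n$. (Under the hypothesis $\sum_i f_i>0$ one has $\{\lambda\in\Gamma:f(\lambda)<\sup_\Gamma f\}=\Gamma$.)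
   Formalization: The formal theorem additionally assumes sup_{∂Γ} f < sup_Γ f, so that the interval for σ is nonempty; without it the claim fails, e.g. for f = λ_1+λ_2 on Γ_2, where (2) holds but (1) and (3) fail. *)

(* Defs.v *)
From mathcomp Require Import all_boot all_order all_algebra all_fingroup.
From mathcomp Require Import all_classical all_reals all_analysis.

Set Implicit Arguments.
Unset Strict Implicit.
Unset Printing Implicit Defensive.

Import Order.TTheory GRing.Theory Num.Theory.
Import numFieldNormedType.Exports.

Local Open Scope classical_set_scope.
Local Open Scope ring_scope.

(* Points of R^n are row vectors 'rV[R]_n.+1 (the dimension is at least 1).
   A function on Gamma is a total function 'rV[R]_n.+1 -> R; every notion below
   only depends on its values on Gamma, Gamma being open. *)

Section Cones.
Context {R : realType} {n : nat}.
Implicit Types (Gamma S : set 'rV[R]_n.+1) (f : 'rV[R]_n.+1 -> R).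

Definition positive_cone : set 'rV[R]_n.+1 :=
  [set lambda | forall i, 0 < lambda 0 i].

Definition boundary S : set 'rV[R]_n.+1 := closure S `\` S°.

Definition symmetric_set S : Prop :=
  forall (s : 'S_n.+1) lambda, S lambda -> S (col_perm s lambda).

Record symmetric_open_convex_cone Gamma : Prop := {
  cone_proper : Gamma `<` setT;
  cone_open : open Gamma;
  cone_convex : convex_set Gamma;
  cone_scale : forall (t : R) lambda, 0 < t -> Gamma lambda ->
    Gamma (t *: lambda);
  cone_symmetric : symmetric_set Gamma;
  cone_boundary : boundary Gamma !=set0;
  cone_positive : positive_cone `<=` Gamma
}.

Definition symmetric_function Gamma f : Prop :=
  forall (s : 'S_n.+1) lambda, Gamma lambda -> f (col_perm s lambda) = f lambda.

Definition concave_function Gamma f : Prop := convex_function Gamma (\- f).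

Definition partial (i : 'I_n.+1) f : 'rV[R]_n.+1 -> R :=
  fun lambda => 'D_(delta_mx 0 i) f lambda.

Definition iter_partial (s : seq 'I_n.+1) f : 'rV[R]_n.+1 -> R :=
  foldr partial f s.

(* C^infinity on an open set: all partial derivatives of all orders exist and
   are continuous. *)
Definition smooth_on Gamma f : Prop :=
  forall (s : seq 'I_n.+1) lambda, Gamma lambda ->
    {for lambda, continuous (iter_partial s f)} /\
    forall i, derivable (iter_partial s f) lambda (delta_mx 0 i).

Definition sup_cone Gamma f : \bar R :=
  ereal_sup [set (f lambda)%:E | lambda in Gamma].

Definition sup_boundary Gamma f : \bar R :=
  ereal_sup
    [set limf_esup (EFin \o f) (within Gamma (nbhs lambda0))
    | lambda0 in boundary Gamma].

Definition level_set Gamma f (sigma : R) : set 'rV[R]_n.+1 :=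
  [set lambda | Gamma lambda /\ f lambda = sigma].

(* lim_{t -> +oo} f (t lambda) exists in the extended reals and is not -oo. *)
Definition ray_limit_gt_ninfty f (lambda : 'rV[R]_n.+1) : Prop :=
  exists2 l : \bar R, (f (t *: lambda))%:E @[t --> +oo] --> l & (-oo < l)%E.

Definition asymptotical_cone Gamma f : set 'rV[R]_n.+1 :=
  [set lambda | Gamma lambda /\ ray_limit_gt_ninfty f lambda].

(* The first two clauses are the standing requirement on the sets S for which
   the notion is defined. *)
Record fully_uniformly_elliptic Gamma f S : Prop := {
  fue_symmetric : symmetric_set S;
  fue_domain : S `<=`
    [set lambda | Gamma lambda /\ ((f lambda)%:E < sup_cone Gamma f)%E];
  fue_nonneg : forall lambda i, Gamma lambda -> 0 <= partial i f lambda;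
  fue_uniform : exists2 theta : R, 0 < theta &
    forall lambda i, S lambda ->
      theta * \sum_j partial j f lambda <= partial i f lambda /\
      0 < theta * \sum_j partial j f lambda
}.

End Cones.

(* Main.v *)
Require Import Defs.
From mathcomp Require Import all_boot all_order all_algebra all_fingroup.
From mathcomp Require Import all_classical all_reals all_analysis.
From mathcomp Require Import ring lra.

Set Implicit Arguments.
Unset Strict Implicit.
Unset Printing Implicit Defensive.

Import Order.TTheory GRing.Theory Num.Theory.
Import numFieldNormedType.Exports.

Local Open Scope classical_set_scope.
Local Open Scope ring_scope.

(** The whole argument rests on the tangent inequality of a concave function,
    [f y <= f x + Df(x).(y - x)] on [Gamma] ([concave_le_tangent]). It has two
    opposite consequences for a direction [v].

    From bounds on [f] to bounds on [Df]: if [f (t v)] stays bounded below as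
    [t -> +oo], then [Df(x).v >= 0] at every [x] of [Gamma], because the tangent
    plane at [x] would otherwise drag [f (t v)] to [-oo]
    ([asymptotical_cone_grad_ge0]). When the last basis vector [e_n] is interior
    to the asymptotical cone, the directions [e_i - theta (1, ..., 1)] all lie
    in that cone for a small [theta > 0], by symmetry of [f], and [Df(x).v >= 0]
    for such a [v] is exactly [f_i(x) >= theta \sum_j f_j(x)], that is, full
    uniform ellipticity in [Gamma]. The latter restricts to any level set, and a
    level [sigma] exists because [sup_boundary Gamma f < sup_cone Gamma f].

    From bounds on [Df] to bounds on [f]: assume full uniform ellipticity with
    constant [theta] on the level set of [sigma]. Then [Df(x).v >= 0] on that
    level set for every [v] at distance less than [theta] from [e_n]. Start at a
    point [x0] with [f x0 > sigma] and move in the direction [v]: the path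
    cannot leave [Gamma], since [f] is below [sigma] near the boundary, and it
    cannot reach the level [sigma] either, since at such a point [x] the tangent
    inequality would give [f x0 <= sigma] ([superlevel_recession]). So
    [x0 + t v] remains in [Gamma] with [f > sigma] for all [t >= 0]. Writing
    [t v = x0 + t (v - x0 / t)], where [v - x0 / t] is again close to [e_n], one
    gets [t v] in [Gamma] and [f (t v) > sigma] for large [t], that is, [v]
    belongs to the asymptotical cone: [e_n] is interior to it. *)

(** * Tangent planes of concave functions *)

Section ConcaveFunctions.
Context {R : realType} {n : nat}.
Implicit Types (Gamma : set 'rV[R]_n.+1) (f : 'rV[R]_n.+1 -> R).

Lemma convex_set_segment Gamma (p : R) x y : convex_set Gamma ->
  0 <= p -> p <= 1 -> Gamma x -> Gamma y -> Gamma (p *: x + (1 - p) *: y).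
Proof.
move=> cvxG p0 p1 Gx Gy.
by have := cvxG x y (Itv01 p0 p1) (mem_set Gx) (mem_set Gy) => /set_mem.
Qed.

Lemma concave_segment Gamma f (p : R) x y : concave_function Gamma f ->
  0 <= p -> p <= 1 -> Gamma x -> Gamma y ->
  p * f x + (1 - p) * f y <= f (p *: x + (1 - p) *: y).
Proof.
move=> ccvf p0 p1 Gx Gy.
have ccv : - f (p *: x + (1 - p) *: y) <= p * - f x + (1 - p) * - f y.
  exact: ccvf (Itv01 p0 p1) x y (mem_set Gx) (mem_set Gy).
by rewrite -lerN2 opprD -!mulrN.
Qed.

(** Jensen's inequality with equal weights is the only multi-point form of
    concavity used: it compares [f] along an arbitrary direction with [f] along
    the coordinate axes. *)
Lemma concave_mean Gamma f m (x : 'I_m.+1 -> 'rV[R]_n.+1) :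
  convex_set Gamma -> concave_function Gamma f -> (forall i, Gamma (x i)) ->
  Gamma (m.+1%:R^-1 *: \sum_i x i) /\
  m.+1%:R^-1 * \sum_i f (x i) <= f (m.+1%:R^-1 *: \sum_i x i).
Proof.
move=> cvxG ccvf; elim: m x => [|m IHm] x Gx.
  by rewrite !big_ord1 invr1 scale1r mul1r; split.
have [Gmean fmean] :=
  IHm (fun i => x (widen_ord (leqnSn m.+1) i)) (fun i => Gx _).
set mean := _ *: _ in Gmean fmean; set fsum := \sum_i _ in fmean.
rewrite big_ord_recr [\sum_i f _]big_ord_recr /= -/fsum.
pose p : R := m.+1%:R / m.+2%:R.
have m1 : m.+1%:R != 0 :> R by rewrite pnatr_eq0.
have m2 : m.+2%:R != 0 :> R by rewrite pnatr_eq0.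
have p0 : 0 <= p by rewrite divr_ge0 ?ler0n.
have p1 : p <= 1 by rewrite ler_pdivrMr ?ltr0n// mul1r ler_nat.
have pE : 1 - p = m.+2%:R^-1.
  by apply: (mulIf m2); rewrite mulrBl /p divfK// mulVf// mul1r -natrB// subSnn.
set total := _ *: (_ + _).
have -> : total = p *: mean + (1 - p) *: x ord_max.
  by rewrite pE /total scalerDr /mean scalerA /p mulrAC divff// mul1r.
split; first exact: convex_set_segment.
apply: le_trans (concave_segment ccvf p0 p1 Gmean (Gx _)).
rewrite pE mulrDr lerD2r.
apply: le_trans (ler_wpM2l p0 fmean).
by rewrite /p mulrA [_ / _ / _]mulrAC divff// mul1r.
Qed.

Lemma cvg_scaled_difference_quotient f x v (c : R) : derivable f x v ->
  h^-1 * (f (x + h *: (c *: v)) - f x) @[h --> 0^'] --> c * 'D_v f x.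
Proof.
move=> df; have [->|c0] := eqVneq c 0.
  rewrite mul0r [X in X @ _ --> _](_ : _ = cst 0); first exact: cvg_cst.
  by apply/funext => h; rewrite scale0r scaler0 addr0 subrr mulr0.
have cc : (fun h : R => c * h) @ 0^' --> 0^'.
  move=> P [e /= e0 eP]; have ec : 0 < e / `|c|.
    by apply: divr_gt0 => //; rewrite normr_gt0.
  exists (e / `|c|) => // h /= hlt h0; apply: eP; last by rewrite mulf_neq0.
  move: hlt; rewrite /= !sub0r !normrN ltr_pdivlMr ?normr_gt0// => h1.
  by rewrite normrM mulrC.
have -> : (fun h => h^-1 * (f (x + h *: (c *: v)) - f x)) =
    cst c \* ((fun h => h^-1 *: ((f \o shift x) (h *: v) - f x)) \o *%R c).
  apply/funext => h /=; rewrite [_ *: (_ - _)]/GRing.scale /= scalerA.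
  by rewrite [_ + x]addrC [c * h]mulrC invfM mulrCA -mulrA mulKf.
exact: cvgM (cvg_cst c) (cvg_comp _ _ cc df).
Qed.

Definition grad_dot f x (v : 'rV[R]_n.+1) : R := \sum_i partial i f x * v 0 i.

Lemma grad_dotB f x v w :
  grad_dot f x (v - w) = grad_dot f x v - grad_dot f x w.
Proof. by rewrite -sumrB; apply: eq_bigr => i _; rewrite !mxE mulrBr. Qed.

Lemma grad_dotZ f x (c : R) v : grad_dot f x (c *: v) = c * grad_dot f x v.
Proof. by rewrite mulr_sumr; apply: eq_bigr => i _; rewrite !mxE mulrCA. Qed.

Lemma nbhs_line (A : set 'rV[R]_n.+1) (x v : 'rV[R]_n.+1) : nbhs x A ->
  \forall t \near (0 : R), A (x + t *: v).
Proof.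
move=> Ax.
have cl : (fun t : R => x + t *: v) @ 0 --> x + 0 *: v.
  apply: cvgD; first exact: cvg_cst.
  by apply: cvgZ; [exact: cvg_id | exact: cvg_cst].
by apply: cl; rewrite scale0r addr0.
Qed.

(** Concavity lets the partial derivatives at [x] control all directions. With
    [v := y - x], [N] the dimension and [t > 0] small, [x] is on the segment
    from [y] to [x - t v], so concavity bounds [t (f y - f x)] by
    [f x - f (x - t v)]. As [x - t v] is the mean of the points
    [x - N t v_i e_i], Jensen's inequality bounds [f (x - t v)] from below by
    the mean of the [f (x - N t v_i e_i)], whose difference quotients in [t]
    tend to [- N v_i f_i(x)]. *)
Lemma concave_le_tangent Gamma f x y : open Gamma -> convex_set Gamma ->
  concave_function Gamma f -> (forall i, derivable f x (delta_mx 0 i)) ->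
  Gamma x -> Gamma y -> f y <= f x + grad_dot f x (y - x).
Proof.
move=> oG cvxG ccvf df Gx Gy; pose v := y - x.
pose N : R := n.+1%:R.
have N0 : N != 0 by rewrite pnatr_eq0.
pose step i : 'rV[R]_n.+1 := (- N * v 0 i) *: delta_mx 0 i.
pose psi (t : R) := \sum_i t^-1 * (f (x + t *: step i) - f x).
have psi_lim : psi t @[t --> 0^'+] --> - N * grad_dot f x v.
  apply: cvg_dnbhs_at_right; rewrite mulr_sumr.
  apply: cvg_big => [|i _]; first exact: add_continuous.
  rewrite [X in _ --> X](_ : _ = (- N * v 0 i) * partial i f x).
    exact: cvg_scaled_difference_quotient.
  by rewrite mulrCA mulrC.
rewrite -lerBlDl -/v; suff : - N * grad_dot f x v <= - N * (f y - f x).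
  by rewrite !mulNr lerN2 ler_pM2l// ltr0n.
apply: (ler_cvg_to psi_lim (cvg_cst _)).
have Gnear : \forall t \near 0^'+, forall i, Gamma (x + t *: step i).
  by apply: filter_forall => i; apply: cvg_within; apply: nbhs_line;
    exact: open_nbhs_nbhs.
near=> t.
have t0 : 0 < t by near: t; exact: nbhs_right_gt.
have Gstep : forall i, Gamma (x + t *: step i) by near: t.
have [Gmean fmean] := concave_mean cvxG ccvf Gstep.
(* The factor [N] in [step] cancels the weight [1 / N] of the mean. *)
have meanE : n.+1%:R^-1 *: \sum_i (x + t *: step i) = x - t *: v.
  rewrite big_split /= sumr_const card_ord scalerDr -[x *+ _]scaler_nat.
  rewrite scalerA mulVf//.
  rewrite scale1r -scaler_sumr; congr (_ + _).
  rewrite [v in RHS]row_sum_delta -scalerN -sumrN !scaler_sumr.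
  apply: eq_bigr => i _.
  rewrite /step -scaleNr !scalerA; congr (_ *: _).
  by rewrite -/N; field.
rewrite meanE in Gmean fmean.
(* [x] has weight [t / (1 + t)] on [y] between [y] and [x - t v]. *)
have p0 : 0 <= t / (1 + t) by rewrite divr_ge0 ?addr_ge0 ?ltW.
have p1 : t / (1 + t) <= 1 by rewrite ler_pdivrMr ?addr_gt0// mul1r lerDr.
have t1 : 1 + t != 0 by rewrite gt_eqF ?addr_gt0.
have := concave_segment ccvf p0 p1 Gy Gmean.
rewrite (_ : _ *: y + _ = x); last first.
  by apply/rowP => i; rewrite !mxE; field.
move=> fseg.
have f_back : t * f y + f (x - t *: v) <= (1 + t) * f x.
  rewrite -ler_pdivrMl ?addr_gt0//; apply: le_trans fseg.
  by rewrite le_eqVlt; apply/orP; left; apply/eqP; field.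
have sum_le : \sum_i f (x + t *: step i) <= N * f (x - t *: v).
  by rewrite -ler_pdivrMl ?ltr0n.
rewrite /psi -mulr_sumr sumrB sumr_const card_ord -[f x *+ _]mulr_natl -/N.
rewrite ler_pdivrMl//.
have := ler_wpM2l (ler0n R n.+1) f_back; rewrite -/N; nra.
Unshelve. all: by end_near. Qed.

End ConcaveFunctions.

(** * Bounds along rays and superlevel sets *)

Lemma ereal_real_between (R : realType) (x y : \bar R) :
  (x < y)%E -> exists r : R, (x < r%:E)%E /\ (r%:E < y)%E.
Proof.
move: x y => [x| |] [y| |] //= xy.
- by exists ((x + y) / 2); move: xy; rewrite !lte_fin => xy; split; lra.
- by exists (x + 1); rewrite lte_fin ltry; split => //; lra.
- by exists (y - 1); rewrite lte_fin ltNyr; split => //; lra.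
- by exists 0; rewrite ltNyr ltry.
Qed.

Section AsymptoticalCone.
Context {R : realType} {n : nat}.
Context (Gamma : set 'rV[R]_n.+1) (f : 'rV[R]_n.+1 -> R).
Context (Gamma_open : open Gamma) (Gamma_convex : convex_set Gamma)
  (Gamma_scale : forall (t : R) x, 0 < t -> Gamma x -> Gamma (t *: x))
  (f_concave : concave_function Gamma f)
  (f_derivable : forall x i, Gamma x -> derivable f x (delta_mx 0 i)).

Lemma le_tangent x y : Gamma x -> Gamma y -> f y <= f x + grad_dot f x (y - x).
Proof. by move=> Gx; apply: concave_le_tangent => // i; exact: f_derivable. Qed.

(** Otherwise the tangent plane at [x], which lies above [f], is affine with
    negative slope along the ray, and eventually falls below [M]. *)
Lemma grad_dot_ge0 x v (M : R) : Gamma x -> Gamma v ->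
  (\forall t \near +oo, M <= f (t *: v)) -> 0 <= grad_dot f x v.
Proof.
move=> Gx Gv fM; rewrite leNgt; apply/negP => gv.
pose C := f x - grad_dot f x x - M.
have [t tlt [t0 Mt]] : exists2 t : R, C / - grad_dot f x v < t &
    0 < t /\ M <= f (t *: v).
  apply: pinfty_ex_gt; first exact: num_real.
  by apply: filterS2 fM (nbhs_pinfty_gt (num_real (0 : R))) => t.
have := le_tangent Gx (Gamma_scale t0 Gv).
rewrite grad_dotB grad_dotZ => ft.
move: tlt; rewrite ltr_pdivrMr ?oppr_gt0// /C; lra.
Qed.

Lemma ray_limit_eventually_ge v : ray_limit_gt_ninfty f v ->
  exists M : R, \forall t \near +oo, M <= f (t *: v).
Proof.
move=> [l fl l_gt]; have [M [_ Ml]] := ereal_real_between l_gt.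
exists M; near=> t; rewrite ltW// -lte_fin; near: t.
exact: fl (open_ereal_gt' Ml).
Unshelve. all: by end_near. Qed.

(** A concave function bounded below along a ray is nondecreasing on it, so the
    limit exists in the extended reals and is the supremum. *)
Lemma eventually_ge_ray_limit v (M : R) : Gamma v ->
  (\forall t \near +oo, M <= f (t *: v)) -> ray_limit_gt_ninfty f v.
Proof.
move=> Gv fM.
(* Monotonicity is only known for positive times, hence the truncation at 1. *)
pose g (t : R) : \bar R := (f (Num.max 1 t *: v))%:E.
have g_nd : {homo g : s t / (s <= t)%R >-> (s <= t)%E}.
  move=> s t st; rewrite lee_fin.
  set s' := Num.max 1 s; set t' := Num.max 1 t.
  have s't' : s' <= t' by rewrite /s' /t' ge_max !le_max lexx st orbT.
  have s0 : 0 < s' by rewrite /s' lt_max ltr01.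
  have t0 : 0 < t' by rewrite /t' lt_max ltr01.
  have := le_tangent (Gamma_scale t0 Gv) (Gamma_scale s0 Gv).
  rewrite -scalerBl grad_dotZ.
  have := grad_dot_ge0 (Gamma_scale t0 Gv) Gv fM.
  nra.
exists (ereal_sup (range g)).
  apply: cvg_trans (nondecreasing_cvge g_nd); apply: near_eq_cvg.
  have t1 : \forall t \near +oo, (1 : R) <= t.
    by apply: nbhs_pinfty_ge; exact: num_real.
  by apply: filterS t1 => t t1; rewrite /g max_r.
apply: (@lt_le_trans _ _ (g 0)); first exact: ltNyr.
by apply: ereal_sup_ubound; exists 0.
Qed.

Lemma asymptotical_cone_grad_ge0 x v : Gamma x -> asymptotical_cone Gamma f v ->
  0 <= grad_dot f x v.
Proof. by move=> Gx [Gv /ray_limit_eventually_ge[M]]; exact: grad_dot_ge0. Qed.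

(** Limits of points of a superlevel set cannot be on the boundary of the cone
    when the level exceeds [sup_boundary]: this is what keeps a path in a
    superlevel set from leaving [Gamma]. *)
Lemma closure_superlevel sigma x : {in Gamma, continuous f} ->
  (sup_boundary Gamma f < sigma%:E)%E ->
  closure [set y | Gamma y /\ sigma < f y] x -> Gamma x /\ sigma <= f x.
Proof.
move=> fcont sup_lt clx.
have Gx : Gamma x.
  apply: contrapT => nGx.
  have bx : boundary Gamma x.
    split; last by move=> /interior_subset.
    by apply: closure_subset clx => y [].
  move: sup_lt; rewrite ltNge => /negP; apply.
  apply: (@le_trans _ _ (limf_esup (EFin \o f) (within Gamma (nbhs x)))).
    apply: le_ereal_inf_tmp => _ [V VF <-].
    have [y [[Gy fy] Vy]] := clx _ VF.
    apply: (@le_trans _ _ (f y)%:E); first by rewrite lee_fin ltW.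
    by apply: ereal_sup_ubound; exists y => //; exact: Vy.
  by apply: ereal_sup_ubound; exists x.
split => //; rewrite leNgt; apply/negP => fx.
have fx_near : \forall y \near x, f y < sigma.
  exact: cvgr_lt (fcont x (mem_set Gx)) _ fx.
have [y [[_ fy] fy']] := clx _ fx_near.
by move: fy; rewrite ltNge ltW.
Qed.

(** The times at which the ray is in the open set [f > sigma] form a subset of
    the nonnegative reals that is open, and also closed: at a limit time where
    [f] equals [sigma], moving back to [x] follows [- v], along which the
    tangent plane does not increase, so that [f x <= sigma]. Connectedness
    concludes. *)
Lemma superlevel_recession sigma x v : {in Gamma, continuous f} ->
  (sup_boundary Gamma f < sigma%:E)%E -> Gamma x -> sigma < f x ->
  (forall y, level_set Gamma f sigma y -> 0 <= grad_dot f y v) ->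
  forall s : R, 0 <= s -> Gamma (x + s *: v) /\ sigma < f (x + s *: v).
Proof.
move=> fcont sup_lt Gx fx v_ge0.
pose U := [set y | Gamma y /\ sigma < f y].
pose ray (s : R) := x + s *: v.
have ray_cont : continuous ray.
  move=> s; apply: cvgD; first exact: cvg_cst.
  by apply: cvgZ; [exact: cvg_id | exact: cvg_cst].
have oU : open U.
  rewrite openE => y [Gy fy]; apply: filterI; first exact: open_nbhs_nbhs.
  exact: cvgr_gt (fcont y (mem_set Gy)) _ fy.
have closed_in s : 0 <= s -> closure U (ray s) -> U (ray s).
  move=> s0 /(closure_superlevel fcont sup_lt) [Gs fs]; split => //.
  rewrite lt_neqAle fs andbT; apply/eqP => fsE.
  have := le_tangent Gs Gx.
  have := v_ge0 _ (conj Gs (esym fsE)).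
  rewrite /ray opprD addNKr -scaleNr grad_dotZ -/(ray s) -fsE.
  nra.
have conn : connected [set s : R | 0 <= s].
  apply/connected_intervalP => a b /= a0 _ c /andP[ac _]; exact: le_trans ac.
suff UE : [set s : R | 0 <= s /\ U (ray s)] = [set s : R | 0 <= s].
  by move=> s s0; have [] : [set s : R | 0 <= s /\ U (ray s)] s by rewrite UE.
apply: conn.
- by exists 0; split => //; rewrite /ray scale0r addr0.
- exists (ray @^-1` U); first by apply: open_comp => // s _; exact: ray_cont.
  by apply/seteqP; split.
- exists (ray @^-1` closure U).
    apply: closed_comp; first by move=> s _; exact: ray_cont.
    exact: closed_closure.
  apply/seteqP; split => s [s0 Us]; split => //; last exact: closed_in.
  exact: subset_closure.
Qed.

End AsymptoticalCone.

(** * Full uniform ellipticity *)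

Section FullyUniformEllipticity.
Context {R : realType} {n : nat}.
Implicit Types (Gamma : set 'rV[R]_n.+1) (f : 'rV[R]_n.+1 -> R).

Lemma entry_le_norm (x : 'rV[R]_n.+1) i : `|x 0 i| <= `|x|.
Proof.
rewrite [leRHS]/Num.Def.normr /= mx_normrE.
exact: (le_bigmax _ (fun ij => `|x ij.1 ij.2|) (0, i)).
Qed.

Lemma grad_dot_delta f x i : grad_dot f x (delta_mx 0 i) = partial i f x.
Proof.
rewrite /grad_dot (bigD1 i)//= mxE !eqxx mulr1 big1 ?addr0// => j ji.
by rewrite mxE (negbTE ji) andbF mulr0.
Qed.

Lemma grad_dot_const f x (c : R) :
  grad_dot f x (const_mx c) = c * \sum_i partial i f x.
Proof. by rewrite mulr_sumr; apply: eq_bigr => i _; rewrite mxE mulrC. Qed.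

Lemma asymptotical_cone_symmetric Gamma f (s : 'S_n.+1) v :
  (forall (t : R) x, 0 < t -> Gamma x -> Gamma (t *: x)) ->
  symmetric_set Gamma -> symmetric_function Gamma f ->
  asymptotical_cone Gamma f v -> asymptotical_cone Gamma f (col_perm s v).
Proof.
move=> Gscale Gsym fsym [Gv [l fl l_gt]]; split; first exact: Gsym.
exists l => //; apply: cvg_trans fl; apply: near_eq_cvg.
have t0 : \forall t \near +oo, (0 : R) < t.
  by apply: nbhs_pinfty_gt; exact: num_real.
apply: filterS t0 => t t0; congr EFin.
rewrite -(fsym s); last exact: Gscale.
by congr f; apply/rowP => i; rewrite !mxE.
Qed.

(** Interiority is only known at the last basis vector; permuting coordinates
    carries it to the others with the same [theta], since constant vectors are
    fixed by permutations. *)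
Lemma interior_asymptotical_cone_shift Gamma f :
  (forall (t : R) x, 0 < t -> Gamma x -> Gamma (t *: x)) ->
  symmetric_set Gamma -> symmetric_function Gamma f ->
  (asymptotical_cone Gamma f)° (delta_mx 0 ord_max) ->
  exists2 theta : R, 0 < theta &
    forall i, asymptotical_cone Gamma f (delta_mx 0 i - const_mx theta).
Proof.
move=> Gscale Gsym fsym int_e.
have near0 : \forall t \near 0^'+,
    asymptotical_cone Gamma f (delta_mx 0 ord_max + t *: const_mx (- 1)).
  by apply: cvg_within; exact: nbhs_line.
near ((0 : R)^'+) => theta.
exists theta; first by near: theta; exact: nbhs_right_gt.
move=> i; have -> : delta_mx 0 i - const_mx theta =
    col_perm (tperm i ord_max) (delta_mx 0 ord_max + theta *: const_mx (- 1))
    :> 'rV[R]_n.+1.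
  apply/rowP => j; rewrite !mxE mulrN1; congr (_ %:R - _).
  by rewrite -{2}(tpermL i ord_max) (inj_eq perm_inj).
by apply: asymptotical_cone_symmetric => //; near: theta.
Unshelve. all: by end_near. Qed.

End FullyUniformEllipticity.

Theorem theorem1p4 (R : realType) (n : nat)
    (Gamma : set 'rV[R]_n.+1) (f : 'rV[R]_n.+1 -> R)
    (Gamma_cone : symmetric_open_convex_cone Gamma)
    (f_levels : (sup_boundary Gamma f < sup_cone Gamma f)%E)
    (f_smooth : smooth_on Gamma f)
    (f_symmetric : symmetric_function Gamma f)
    (f_concave : concave_function Gamma f)
    (f_limit : forall lambda, positive_cone lambda ->
      ray_limit_gt_ninfty f lambda)
    (f_sum : forall lambda, Gamma lambda -> 0 < \sum_i partial i f lambda) :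
  [<-> (asymptotical_cone Gamma f)° (delta_mx 0 ord_max);
       fully_uniformly_elliptic Gamma f Gamma;
       exists sigma : R,
         [/\ (sup_boundary Gamma f < sigma%:E)%E,
             (sigma%:E < sup_cone Gamma f)%E
           & fully_uniformly_elliptic Gamma f (level_set Gamma f sigma)]].
Proof.
have [_ Gamma_open Gamma_convex Gamma_scale Gamma_sym _ _] := Gamma_cone.
have f_der x i : Gamma x -> derivable f x (delta_mx 0 i).
  by move=> Gx; have [_] := f_smooth [::] x Gx; apply.
have f_cont : {in Gamma, continuous f}.
  by move=> x /set_mem Gx; have [] := f_smooth [::] x Gx.
tfae.
- move=> /(interior_asymptotical_cone_shift Gamma_scale Gamma_sym f_symmetric).
  move=> [theta theta0 cone_theta].
  have fi_ge x i : Gamma x -> theta * \sum_j partial j f x <= partial i f x.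
    move=> Gx; rewrite -subr_ge0 -grad_dot_const -grad_dot_delta -grad_dotB.
    exact: (asymptotical_cone_grad_ge0 Gamma_open).
  have sum_gt0 x : Gamma x -> 0 < theta * \sum_j partial j f x.
    by move=> /f_sum; exact: mulr_gt0.
  split => //.
  + move=> x Gx; split => //.
    (* The tangent inequality at [x + t (1, ..., 1)] shows that [f] is larger
       there than at [x], so [f x] is not the supremum. *)
    have [t t0 Gt] : exists2 t : R, 0 < t & Gamma (x + t *: const_mx 1).
      near ((0 : R)^'+) => t; exists t; first by near: t; exact: nbhs_right_gt.
      by near: t; apply: cvg_within; apply: nbhs_line; exact: open_nbhs_nbhs.
    apply: (@lt_le_trans _ _ (f (x + t *: const_mx 1))%:E); last first.
      by apply: ereal_sup_ubound; exists (x + t *: const_mx 1).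
    rewrite lte_fin; apply: le_lt_trans (le_tangent _ _ _ _ Gt Gx) _ => //.
    rewrite opprD addNKr -scaleNr grad_dotZ grad_dot_const mul1r.
    by rewrite gtrDl mulNr oppr_lt0 mulr_gt0 ?f_sum.
  + by move=> x i Gx; exact: le_trans (ltW (sum_gt0 _ Gx)) (fi_ge _ _ Gx).
  + by exists theta => // x i Gx; split; [exact: fi_ge | exact: sum_gt0].
- move=> [_ dom fi_ge0 [theta theta0 unif]].
  have [sigma [sup_lt lt_sup]] := ereal_real_between f_levels.
  exists sigma; split => //; split => //.
  + by move=> s x [Gx fx]; split; [exact: Gamma_sym | rewrite f_symmetric].
  + by move=> x [Gx _]; exact: dom.
  + by exists theta => // x i [Gx _]; exact: unif.
- move=> [sigma [sup_lt lt_sup [_ _ fi_ge0 [theta theta0 unif]]]].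
  have [_ [x0 Gx0 <-]] := ereal_sup_gt lt_sup; rewrite lte_fin => fx0.
  pose e : 'rV[R]_n.+1 := delta_mx 0 ord_max.
  have dual v x : `|e - v| < theta -> level_set Gamma f sigma x ->
      0 <= grad_dot f x v.
    move=> ev Sx; have [Gx _] := Sx; have [fe _] := unif x ord_max Sx.
    (* [Df(x).v = f_n(x) - Df(x).(e - v)], and the last term is at most
       [theta] times the sum of the [f_i(x)], which are nonnegative. *)
    rewrite -[v](subKr e) grad_dotB grad_dot_delta subr_ge0.
    apply: le_trans fe; rewrite mulr_sumr; apply: ler_sum => i _.
    rewrite mulrC; apply: ler_wpM2r; first exact: fi_ge0.
    exact: le_trans (ler_norm _) (le_trans (entry_le_norm _ _) (ltW ev)).
  apply/nbhs_ballP; exists theta => //= v; rewrite -ball_normE /= -/e => ev.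
  have ray : \forall t \near +oo, Gamma (t *: v) /\ sigma < f (t *: v).
    have large : \forall t \near +oo, `|x0| / (theta - `|e - v|) < t.
      by apply: nbhs_pinfty_gt; exact: num_real.
    apply: filterS large => t; rewrite ltr_pdivrMr ?subr_gt0// => tlt.
    have t0 : 0 < t.
      rewrite -(pmulr_lgt0 _ (_ : 0 < theta - `|e - v|)) ?subr_gt0//.
      exact: le_lt_trans tlt.
    (* The ray from [x0] in the direction [v - x0 / t] is at [t v] at time
       [t]. *)
    have close : `|e - (v - t^-1 *: x0)| < theta.
      rewrite opprB addrA addrAC; apply: le_lt_trans (ler_normD _ _) _.
      rewrite -ltrBrDl normrZ gtr0_norm ?invr_gt0//.
      by rewrite ltr_pdivrMl.
    have := superlevel_recession Gamma_open Gamma_convex f_concave f_der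
      f_cont sup_lt Gx0 fx0 (fun y => dual _ y close) (ltW t0).
    rewrite scalerBr scalerA divff ?gt_eqF// scale1r addrC subrK.
    exact.
  have [t t0 [Gt _]] :
      exists2 t : R, 0 < t & Gamma (t *: v) /\ sigma < f (t *: v).
    exact: pinfty_ex_gt0.
  have Gv : Gamma v.
    rewrite -[v]scale1r -(mulVf (lt0r_neq0 t0)) -scalerA.
    by apply: Gamma_scale => //; rewrite invr_gt0.
  have ray_ge : \forall s \near +oo, sigma <= f (s *: v).
    by apply: filterS ray => s [_ /ltW].
  by split => //; apply: (eventually_ge_ray_limit Gamma_open) ray_ge.
Unshelve. all: by end_near. Qed.
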